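(* Let $T=3$, $L=\ell=2$, and suppose $\underline{C}\le\overline{V}<\underline{C}+V$, $\overline{C}-\overline{V}-V\ge 0$ and $\overline{C}-\underline{C}-2V\ge 0$. Then $\mathrm{conv}(P)$ is the set of all $(x,y,u)=(x_1,x_2,x_3,y_1,y_2,y_3,u_2,u_3)\in\mathbb{R}^8$ satisfying \begin{align*} & u_2+u_3\le y_3,\qquad y_1+u_2+u_3\le 1,\\ & u_2\ge y_2-y_1,\quad u_3\ge y_3-y_2,\quad u_2\ge 0,\quad u_3\ge 0,\\ & x_1\ge\underline{C}y_1,\quad x_2\ge\underline{C}y_2,\quad x_3\ge\underline{C}y_3,\\ & x_1\le\overline{V}y_1+V(y_2-u_2)+(\overline{C}-\overline{V}-V)(y_3-u_3-u_2),\\ & x_2\le\overline{V}y_2+(\overline{C}-\overline{V})(y_3-u_3-u_2),\\ & x_3\le\overline{C}y_3-(\overline{C}-\overline{V})u_3-(\overline{C}-\overline{V}-V)u_2,\\ & x_2-x_1\le\overline{V}y_2-\underline{C}y_1+(\underline{C}+V-\overline{V})(y_3-u_3-u_2),\\ & x_3-x_2\le(\underline{C}+V)y_3-\underline{C}y_2-(\underline{C}+V-\overline{V})u_3,\\ & x_1-x_2\le\overline{V}y_1-(\overline{V}-V)y_2-(\underline{C}+V-\overline{V})u_2,\\ & x_2-x_3\le\overline{V}y_2-\underline{C}y_3+(\underline{C}+V-\overline{V})(y_3-u_3-u_2),\\ & x_3-x_1\le(\underline{C}+2V)y_3-\underline{C}y_1-(\underline{C}+2V-\overline{V})u_3-(\underline{C}+V-\overline{V})u_2,\\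 & x_1-x_3\le\overline{V}y_1-\underline{C}y_3+V(y_2-u_2)+(\underline{C}+V-\overline{V})(y_3-u_3-u_2),\\ & x_1-x_2+x_3\le\overline{V}y_1-(\overline{V}-V)y_2+\overline{V}y_3+(\overline{C}-\overline{V})(y_3-u_3-u_2). \end{align*}
   Context: $T$ is the number of time periods, $L,\ell$ are positive integers (minimum-up and minimum-down time), and $\underline{C},\overline{C},\overline{V},V$ are real parameters (generation lower bound, generation upper bound, start-up/shut-down ramp rate, ramp rate in the stable region) with $0\le\underline{C}\le\overline{V}\le\overline{C}$ and $V>0$. For integers $a,b$, $[a,b]_{\mathbb{Z}}$ is the set of integers $i$ with $a\le i\le b$. $P$ is the set of $(x,y,u)\in\mathbb{R}_+^T\times\{0,1\}^T\times\{0,1\}^{T-1}$, with $x=(x_1,\dots,x_T)$, $y=(y_1,\dots,y_T)$, $u=(u_2,\dots,u_T)$, such that \begin{align*} &\textstyle\sum_{i=t-L+1}^{t}u_i\le y_t,\ t\in[L+1,T]_{\mathbb{Z}};\qquad \sum_{i=t-\ell+1}^{t}u_i\le 1-y_{t-\ell},\ t\in[\ell+1,T]_{\mathbb{Z}};\\ &y_t-y_{t-1}-u_t\le 0,\ t\in[2,T]_{\mathbb{Z}};\qquad \underline{C}y_t\le x_t\le\overline{C}y_t,\ t\in[1,T]_{\mathbb{Z}};\\ &x_t-x_{t-1}\le Vy_{t-1}+\overline{V}(1-y_{t-1}),\ t\in[2,T]_{\mathbb{Z}};\qquad x_{t-1}-x_t\le Vy_t+\overline{V}(1-y_t),\ t\in[2,T]_{\mathbb{Z}}.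 \end{align*} $\mathrm{conv}(P)$ denotes the convex hull of $P$. *)

(* Defs.v *)
From HB Require Import structures.
From mathcomp Require Import all_boot all_order all_algebra.
From mathcomp Require Import boolp classical_sets reals convex.

Set Implicit Arguments.
Unset Strict Implicit.
Unset Printing Implicit Defensive.

Import Order.TTheory GRing.Theory Num.Theory.

Local Open Scope classical_set_scope.
Local Open Scope ring_scope.

Definition convex_hull (R : realType) (E : lmodType R) (A : set E) : set E :=
  smallest (@convex_set R E) A.

(* The space of triples (x, y, u) with x = (x_1, ..., x_T), y = (y_1, ..., y_T)
   and u = (u_2, ..., u_T). *)
Definition uc_space (R : realType) (T : nat) : lmodType R :=
  ('rV[R]_T * 'rV[R]_T * 'rV[R]_T.-1)%type.

(* The component labelled t of a vector whose first component is labelled a.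
   The value is junk unless a <= t < a + n. *)
Definition component (R : realType) (a n : nat) (v : 'rV[R]_n) (t : nat) : R :=
  oapp (v ord0) 0 (insub (t - a)%N).

Definition xc (R : realType) (T : nat) (p : uc_space R T) (t : nat) : R :=
  component 1 p.1.1 t.

Definition yc (R : realType) (T : nat) (p : uc_space R T) (t : nat) : R :=
  component 1 p.1.2 t.

Definition uc (R : realType) (T : nat) (p : uc_space R T) (t : nat) : R :=
  component 2 p.2 t.

(* L, l: minimum-up and minimum-down times; Cmin, Cmax: generation bounds;
   Vbar: start-up/shut-down ramp rate; V: ramp rate in the stable region. *)
Definition uc_feasible (R : realType) (T L l : nat) (Cmin Cmax Vbar V : R) :
    set (uc_space R T) :=
  [set p | let x := xc p in let y := yc p in let u := uc p in
    (forall t, (1 <= t <= T)%N -> 0 <= x t)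
    /\ (forall t, (1 <= t <= T)%N -> y t = 0 \/ y t = 1)
    /\ (forall t, (2 <= t <= T)%N -> u t = 0 \/ u t = 1)
    /\ (forall t, (L + 1 <= t <= T)%N ->
          \sum_(t - L + 1 <= i < t.+1) u i <= y t)
    /\ (forall t, (l + 1 <= t <= T)%N ->
          \sum_(t - l + 1 <= i < t.+1) u i <= 1 - y (t - l)%N)
    /\ (forall t, (2 <= t <= T)%N -> y t - y t.-1 - u t <= 0)
    /\ (forall t, (1 <= t <= T)%N -> Cmin * y t <= x t <= Cmax * y t)
    /\ (forall t, (2 <= t <= T)%N ->
          x t - x t.-1 <= V * y t.-1 + Vbar * (1 - y t.-1))
    /\ (forall t, (2 <= t <= T)%N ->
          x t.-1 - x t <= V * y t + Vbar * (1 - y t))].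

Arguments uc_feasible {R} T L l Cmin Cmax Vbar V _.

(* Main.v *)
(* The system on (y, u) has exactly six 0/1 solutions: the on-patterns 000, 100,
   110, 111, 011 (with u_2 = 1) and 001 (with u_3 = 1).  They are affinely
   independent, so a point (y, u) of the polytope has unique barycentric
   coordinates 1 - y_1 - u_2 - u_3, y_1 - y_2 + u_2, y_2 - y_3 + u_3,
   y_3 - u_2 - u_3, u_2 and u_3 over them.  Hence (x, y, u) is in the hull iff
   x is a Minkowski sum of the dilated polytopes of generation levels attached
   to the six patterns.  After subtracting Cmin y from x, the generation c of
   the pattern 111 is chosen greedily: c_2 minimal, then c_1 and c_3 maximal. *)
Require Import Defs.
From mathcomp Require Import all_boot all_order all_algebra.
From mathcomp Require Import boolp classical_sets reals convex.
From mathcomp Require Import interval_inference ring lra.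

Import Order.TTheory GRing.Theory Num.Theory.

Local Open Scope classical_set_scope.
Local Open Scope ring_scope.

(** * Splitting a trajectory into the contributions of the patterns *)

(* The case c = k = 0 of trajectory_split. *)
Lemma split_transient (R : realDomainType) (a b b' d d' e z1 z2 z3 : R) :
  0 <= a -> 0 <= b <= b' -> 0 <= d <= d' -> 0 <= e ->
  0 <= z1 <= a + b + b' -> 0 <= z2 <= b + d -> 0 <= z3 <= e + d + d' ->
  z1 - z2 <= a + b' -> z3 - z2 <= e + d' ->
  z1 - z2 + z3 <= a + b' + e + d' ->
  exists a1 b1 b2 d2 d3 e3 : R,
    [/\ z1 = a1 + b1, z2 = b2 + d2 & z3 = d3 + e3] /\
    [/\ 0 <= a1 <= a, 0 <= b1 <= b2 + b' & 0 <= b2 <= b] /\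
    [/\ 0 <= d2 <= d, 0 <= d3 <= d2 + d' & 0 <= e3 <= e].
Proof.
move=> a0 /andP[b0 bb'] /andP[d0 dd'] e0 /andP[z10 z1u] /andP[z20 z2u].
move=> /andP[z30 z3u] h12 h32 h123.
(* These bounds on [b2] say that [d2 = z2 - b2] is admissible and that the intervals left for [b1]
   and [d3] are nonempty. Each lower bound lies below each upper bound, the pair [z1 - a - b'],
   [z2 - z3 + e + d'] being the last hypothesis, so the largest lower bound serves. *)
have [b2 [l1 l2 l3] [u1 u2 u3]] : exists2 b2 : R,
    [/\ 0 <= b2, z1 - a - b' <= b2 & z2 - d <= b2] &
    [/\ b2 <= b, b2 <= z2 & b2 <= z2 - z3 + e + d'].
  exists (Num.max 0 (Num.max (z1 - a - b') (z2 - d))).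
    by rewrite !le_max !lexx !orbT.
  by rewrite !ge_max; split; do ?[apply/andP; split]; lra.
have [b1 [n1 n2] [n3 n4]] : exists2 b1 : R,
    0 <= b1 /\ z1 - a <= b1 & b1 <= b2 + b' /\ b1 <= z1.
  exists (Num.max 0 (z1 - a)); first by rewrite !le_max !lexx !orbT.
  clear - a0 b0 bb' z10 z1u l1 l2.
  by rewrite !ge_max; split; apply/andP; split; lra.
have [d3 [r1 r2] [r3 r4]] : exists2 d3 : R,
    0 <= d3 /\ z3 - e <= d3 & d3 <= z2 - b2 + d' /\ d3 <= z3.
  exists (Num.max 0 (z3 - e)); first by rewrite !le_max !lexx !orbT.
  clear - e0 d0 dd' z30 z3u u2 u3.
  by rewrite !ge_max; split; apply/andP; split; lra.
exists (z1 - b1), b1, b2, (z2 - b2), d3, (z3 - d3).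
clear - l1 l3 u1 u2 n1 n2 n3 n4 r1 r2 r3 r4.
by do !split; do ?[apply/andP; split]; lra.
Qed.

(** For fixed [c2], the largest admissible [c1] leaves the smallest remainder to the transient
    patterns. The case [c1 = k] relies on [c2 <= k + x2 - x1 + a + b'], the case [c1 = x1] on
    [c2 <= x1 + c], and the case [c1 = c2 + c] on the lower bound for [c2]. Reversing time, with
    [e], [d], [d'] for [a], [b], [b'], yields [c3]. *)
Lemma split_stable_end (R : realDomainType) (a b b' c k x1 x2 c2 : R) :
  0 <= c -> 0 <= c2 <= k -> 0 <= x1 <= a + b + b' + k ->
  x1 - x2 <= a + b' + c ->
  0 <= a -> 0 <= b <= b' -> x1 - a - b - b' - c <= c2 ->
  c2 <= x2 -> c2 <= x1 + c -> c2 <= k + x2 - x1 + a + b' ->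
  let c1 := Num.min k (Num.min x1 (c2 + c)) in
  [/\ 0 <= c1 <= k, c2 - c <= c1 <= c2 + c, 0 <= x1 - c1 <= a + b + b' &
      (x1 - c1) - (x2 - c2) <= a + b'].
Proof.
move=> c0 /andP[c20 c2k] /andP[x10 x1k] h12 a0 /andP[b0 bb'] l1 u1 u2 u3 c1.
by rewrite /c1; case: (leP x1 (c2 + c)) => ?; case: (leP k) => ?;
   split; try (apply/andP; split); lra.
Qed.

(* With wA, wB, wC, wD, wE the weights of the patterns 100, 110, 111, 011, 001,
   this is applied to a = wA (Vbar - Cmin), (b, b') = wB (Vbar - Cmin, V),
   (c, k) = wC (V, Cmax - Cmin), (d, d') = wD (Vbar - Cmin, V) and
   e = wE (Vbar - Cmin). *)
Lemma trajectory_split (R : realDomainType)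
    (a b b' c k d d' e x1 x2 x3 : R) :
  0 <= a -> 0 <= b <= b' -> 0 <= c -> 2 * c <= k -> 0 <= d <= d' -> 0 <= e ->
  0 <= x1 <= a + b + b' + k -> 0 <= x2 <= b + d + k ->
  0 <= x3 <= e + d + d' + k ->
  x2 - x1 <= b + d + c -> x2 - x3 <= b + d + c ->
  x1 - x2 <= a + b' + c -> x3 - x2 <= e + d' + c ->
  x1 - x3 <= a + b + b' + 2 * c -> x3 - x1 <= e + d + d' + 2 * c ->
  x1 - x2 + x3 <= a + b' + e + d' + c + k ->
  exists a1 b1 b2 c1 c2 c3 d2 d3 e3 : R,
    [/\ x1 = a1 + b1 + c1, x2 = b2 + c2 + d2 & x3 = c3 + d3 + e3] /\
    [/\ 0 <= a1 <= a, 0 <= b1 <= b2 + b', 0 <= b2 <= b,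
        0 <= d2 <= d & 0 <= d3 <= d2 + d'] /\
    [/\ 0 <= e3 <= e, 0 <= c1 <= k, 0 <= c2 <= k & 0 <= c3 <= k] /\
    [/\ c1 - c2 <= c, c2 - c1 <= c, c2 - c3 <= c & c3 - c2 <= c].
Proof.
move=> a0 /andP[b0 bb'] c0 ck /andP[d0 dd'] e0 /andP[x10 x1k] /andP[x20 x2k].
move=> /andP[x30 x3k] h21 h23 h12 h32 h13 h31 h123.
(* The bounds on [c2] express that [x2 - c2] lies between 0 and [b + d], that [split_stable_end]
   applies at both ends, and that the remainders satisfy the joint bound of [split_transient] when
   [c1] and [c3] both equal [c2 + c] ([l3]) or both equal [k] ([u7]). *)
have [c2 [[l1 l2 l3] [l4 l5 u1] [u2 u3 u4] [u5 u6 u7]]] : exists c2 : R, [/\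
    [/\ 0 <= c2, x2 - b - d <= c2 &
        x1 - x2 + x3 - a - b' - e - d' - 2 * c <= c2],
    [/\ x1 - a - b - b' - c <= c2, x3 - e - d - d' - c <= c2 & c2 <= k],
    [/\ c2 <= x2, c2 <= x1 + c & c2 <= x3 + c] &
    [/\ c2 <= k + x2 - x1 + a + b', c2 <= k + x2 - x3 + e + d' &
        c2 <= 2 * k + x2 - x1 - x3 + a + b' + e + d']].
  exists (Num.max 0 (Num.max (x2 - b - d)
    (Num.max (x1 - x2 + x3 - a - b' - e - d' - 2 * c)
    (Num.max (x1 - a - b - b' - c) (x3 - e - d - d' - c))))).
  by do !split; rewrite ?le_max ?ge_max ?lexx ?orbT //;
     do ?[apply/andP; split]; lra.
have c2k : 0 <= c2 <= k by rewrite l1.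
have [| | | | | | | |p1 /andP[p3 p4] p5 p6] :=
  split_stable_end _ a b b' c k x1 x2 c2 c0 c2k => //; rewrite ?x10 ?b0 //.
have [| | | | | | | |q1 /andP[q3 q4] q5 q6] :=
  split_stable_end _ e d d' c k x3 x2 c2 c0 c2k => //; rewrite ?x30 ?d0 //.
set c1 := Num.min _ _ in p1 p3 p4 p5 p6.
set c3 := Num.min _ _ in q1 q3 q4 q5 q6.
(* If the remainder at one end vanishes, the bound at the other end suffices. When one minimum is
   [k] and the other is [c2 + c], [c2] cancels and the claim is [h123]. *)
have c13 : (x1 - c1) - (x2 - c2) + (x3 - c3) <= a + b' + e + d'.
  rewrite /c1 /c3; clear - a0 b0 bb' d0 dd' e0 h12 h32 h123 l3 u2 u5 u6 u7.
  by rewrite /Order.min; do !case: ifP => _; lra.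
clear - a0 b0 bb' d0 dd' e0 l2 u2 p1 p3 p4 p5 p6 q1 q3 q4 q5 q6 c13 l1 u1.
have z2P : 0 <= x2 - c2 <= b + d by clear - l2 u2; apply/andP; split; lra.
have bP : 0 <= b <= b' by rewrite b0.
have dP : 0 <= d <= d' by rewrite d0.
have [a1 [b1 [b2 [d2 [d3 [e3 [[z1E z2E z3E]
    [[hA hB1 hB2] [hD2 hD3 hE]]]]]]]]] :=
  split_transient R a b b' d d' e _ _ _ a0 bP dP e0 p5 z2P q5 p6 q6 c13.
exists a1, b1, b2, c1, c2, c3, d2, d3, e3.
split; first by split; [rewrite -z1E|rewrite addrAC -z2E|
  rewrite -addrA -z3E addrC]; rewrite subrK.
split; first by split.
split; first by split=> //; rewrite l1.
by clear - p3 p4 q3 q4; split; lra.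
Qed.

(** * Dilates of a convex set *)

(** Membership of [z] in the dilate [w S]. Exhibiting [s], rather than dividing [z] by [w], keeps
    the notion meaningful for [w = 0]. *)
Definition scaled (R : realType) (E : lmodType R) (S : set E) (w : R)
    (z : E) : Prop :=
  exists2 s, S s & z = w *: s.

Lemma convex_combination (R : realType) (E : lmodType R) (S : set E)
    (s t : E) (k : R) :
  convex_set S -> S s -> S t -> 0 <= k <= 1 -> S (k *: s + (1 - k) *: t).
Proof.
move=> cS Ss St /andP[k0 k1].
(* [convex_set] quantifies over reals packaged with a proof that they lie in the unit interval. *)
have k01 : Itv.spec (@Itv.num_sem R)
    (Itv.Real (Interval (BSide true 0%Z) (BSide false 1%Z))) k.
  by rewrite /= /Itv.num_sem /= ger0_real// in_itv/= k0.
have := cS s t (Itv.mk k01); rewrite !inE => /(_ Ss St).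
exact.
Qed.

(** The witness is the average of [s1] and [s2] with weights proportional to [w1] and [w2]. Pieces
    can thus be added one at a time, with no convex combination of six points to handle. *)
Lemma scaledD (R : realType) (E : lmodType R) (S : set E) (w1 w2 : R)
    (z1 z2 : E) :
  convex_set S -> 0 <= w1 -> 0 <= w2 -> scaled R E S w1 z1 ->
  scaled R E S w2 z2 -> scaled R E S (w1 + w2) (z1 + z2).
Proof.
move=> cS w10 w20 [s1 Ss1 ->] [s2 Ss2 ->].
have [w0|w_neq0] := eqVneq (w1 + w2) 0.
  have [-> ->] : w1 = 0 /\ w2 = 0 by split; lra.
  by exists s1; rewrite // addr0 !scale0r addr0.
have w_gt0 : 0 < w1 + w2 by rewrite lt_def w_neq0 addr_ge0.
exists (w1 / (w1 + w2) *: s1 + (1 - w1 / (w1 + w2)) *: s2).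
  apply: convex_combination => //.
  by rewrite divr_ge0 ?addr_ge0 //= ler_pdivrMr// mul1r lerDl.
by rewrite scalerDr !scalerA mulrBr mulr1 mulrC divfK// addrAC subrr add0r.
Qed.

(** * Coordinates of points for three periods *)

Lemma component_affine (R : realType) (a n : nat) (k l : R) (v w : 'rV[R]_n)
    (t : nat) :
  component a (k *: v + l *: w) t = k * component a v t + l * component a w t.
Proof.
by rewrite /component; case: insub => [i|] /=; rewrite ?mxE // !mulr0 addr0.
Qed.

(** This holds for every [t]: both sides truncate [t - a] at 0 and return 0 past the end of [s]. *)
Lemma component_row (R : realType) (a n t : nat) (s : seq R) :
  (size s <= n)%N -> component a (\row_(i < n) s`_i) t = s`_(t - a)%N.
Proof.
rewrite /component => sn; case: insubP => [i _ <-|]; first by rewrite /= mxE.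
by rewrite -leqNgt => nt; rewrite /= nth_default // (leq_trans sn nt).
Qed.

Definition schedule (R : realType) (x1 x2 x3 y1 y2 y3 u2 u3 : R) :
    uc_space R 3 :=
  (\row_(i < 3) [:: x1; x2; x3]`_i, \row_(i < 3) [:: y1; y2; y3]`_i,
   \row_(i < 2) [:: u2; u3]`_i).

Lemma xc_schedule (R : realType) (x1 x2 x3 y1 y2 y3 u2 u3 : R) (t : nat) :
  xc (schedule R x1 x2 x3 y1 y2 y3 u2 u3) t = [:: x1; x2; x3]`_(t - 1)%N.
Proof. exact: component_row. Qed.

Lemma yc_schedule (R : realType) (x1 x2 x3 y1 y2 y3 u2 u3 : R) (t : nat) :
  yc (schedule R x1 x2 x3 y1 y2 y3 u2 u3) t = [:: y1; y2; y3]`_(t - 1)%N.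
Proof. exact: component_row. Qed.

Lemma uc_schedule (R : realType) (x1 x2 x3 y1 y2 y3 u2 u3 : R) (t : nat) :
  uc (schedule R x1 x2 x3 y1 y2 y3 u2 u3) t = [:: u2; u3]`_(t - 2)%N.
Proof. exact: component_row. Qed.

Lemma scheduleE (R : realType) (p : uc_space R 3) :
  p = schedule R (xc p 1) (xc p 2) (xc p 3) (yc p 1) (yc p 2) (yc p 3)
              (uc p 2) (uc p 3).
Proof.
case: p => [[x y] u]; congr (_, _, _); apply/rowP => i; rewrite mxE.
- case: i => [[|[|[|//]]] i] /=; rewrite /xc /component insubT /=;
    by congr (x _ _); apply/val_inj.
- case: i => [[|[|[|//]]] i] /=; rewrite /yc /component insubT /=;
    by congr (y _ _); apply/val_inj.
- case: i => [[|[|//]] i] /=; rewrite /uc /component insubT /=;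
    by congr (u _ _); apply/val_inj.
Qed.

Lemma scheduleD (R : realType) (x1 x2 x3 y1 y2 y3 u2 u3
    x1' x2' x3' y1' y2' y3' u2' u3' : R) :
  schedule R x1 x2 x3 y1 y2 y3 u2 u3 +
  schedule R x1' x2' x3' y1' y2' y3' u2' u3' =
  schedule R (x1 + x1') (x2 + x2') (x3 + x3') (y1 + y1') (y2 + y2') (y3 + y3')
          (u2 + u2') (u3 + u3').
Proof.
congr (_, _, _); apply/rowP => i; rewrite !mxE;
  by case: i => [[|[|[|//]]]].
Qed.

Lemma scheduleZ (R : realType) (k x1 x2 x3 y1 y2 y3 u2 u3 : R) :
  k *: schedule R x1 x2 x3 y1 y2 y3 u2 u3 =
  schedule R (k * x1) (k * x2) (k * x3) (k * y1) (k * y2) (k * y3)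
          (k * u2) (k * u3).
Proof.
congr (_, _, _); apply/rowP => i; rewrite !mxE;
  by case: i => [[|[|[|//]]]].
Qed.

(** * The feasible set in scalar coordinates, and its dilates *)

Definition feasible_coords (R : realType) (Cmin Cmax Vbar V
    x1 x2 x3 y1 y2 y3 u2 u3 : R) : Prop :=
  [/\ (y1 = 0 \/ y1 = 1), (y2 = 0 \/ y2 = 1), (y3 = 0 \/ y3 = 1),
      (u2 = 0 \/ u2 = 1) & (u3 = 0 \/ u3 = 1)] /\
  [/\ u2 + u3 <= y3, u2 + u3 <= 1 - y1, y2 - y1 <= u2 & y3 - y2 <= u3] /\
  [/\ Cmin * y1 <= x1 <= Cmax * y1, Cmin * y2 <= x2 <= Cmax * y2 &
      Cmin * y3 <= x3 <= Cmax * y3] /\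
  [/\ x2 - x1 <= V * y1 + Vbar * (1 - y1), x3 - x2 <= V * y2 + Vbar * (1 - y2),
      x1 - x2 <= V * y2 + Vbar * (1 - y2) &
      x2 - x3 <= V * y3 + Vbar * (1 - y3)].

Lemma uc_feasible3E (R : realType) (Cmin Cmax Vbar V : R) (p : uc_space R 3) :
  0 <= Cmin ->
  uc_feasible 3 2 2 Cmin Cmax Vbar V p <->
  feasible_coords R Cmin Cmax Vbar V (xc p 1) (xc p 2) (xc p 3)
    (yc p 1) (yc p 2) (yc p 3) (uc p 2) (uc p 3).
Proof.
have sum2 (f : nat -> R) : \sum_(2 <= i < 4) f i = f 2 + f 3.
  by rewrite big_ltn // big_nat1.
move=> Cmin0; rewrite /uc_feasible /feasible_coords /=.
move: (xc p) (yc p) (uc p) => x y u {p}; split.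
  move=> [_ [hy [hu [hup [hdown [hswitch [hC [hR1 hR2]]]]]]]].
  (* For [T = 3] and [L = l = 2], the minimum-up and minimum-down constraints occur only at [t = 3],
     where the window is periods 2 and 3. *)
  have hup3 : u 2 + u 3 <= y 3 by rewrite -sum2; exact: (hup 3).
  have hdown3 : u 2 + u 3 <= 1 - y 1 by rewrite -sum2; exact: (hdown 3).
  have /= := hswitch 2 isT; have /= := hswitch 3 isT => s3 s2.
  split; first by split; [apply: hy|apply: hy|apply: hy|apply: hu|apply: hu].
  split; first by split => //; lra.
  split; first by split; apply: hC.
  by split; [apply: (hR1 2)|apply: (hR1 3)|apply: (hR2 2)|apply: (hR2 3)].
move=> [[hy1 hy2 hy3 hu2 hu3] [[hup hdown s2 s3] [[hC1 hC2 hC3]]]].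
move=> [r1 r2 r3 r4].
(* Nonnegativity of generation is recovered from the lower bound [Cmin * y <= x]. *)
have x_ge0 r s : (s = 0 \/ s = 1) -> Cmin * s <= r <= Cmax * s -> 0 <= r.
  by move=> hs /andP[+ _]; apply: le_trans; case: hs => ->; rewrite mulr_ge0.
split; first by move=> [|[|[|[|t]]]]// _; [apply: x_ge0 hC1|apply: x_ge0 hC2|
    apply: x_ge0 hC3].
split; first by move=> [|[|[|[|t]]]].
split; first by move=> [|[|[|[|t]]]].
split; first by move=> [|[|[|[|t]]]]// _; rewrite sum2.
split; first by move=> [|[|[|[|t]]]]// _; rewrite sum2.
split; first by move=> [|[|[|[|t]]]]//= _; lra.
split; first by move=> [|[|[|[|t]]]].
by split; move=> [|[|[|[|t]]]].
Qed.

(** For [w > 0] the constraints are divided by [w]; for [w = 0] the bounds force [z = 0], and the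
    all-zero schedule is the witness. Multiplying the constraints by [w] states both cases at
    once. *)
Lemma scaled_feasible (R : realType) (Cmin Cmax Vbar V
    w y1 y2 y3 u2 u3 z1 z2 z3 : R) :
  0 <= Cmin -> 0 <= Vbar -> 0 <= w ->
  [/\ (y1 = 0 \/ y1 = 1), (y2 = 0 \/ y2 = 1), (y3 = 0 \/ y3 = 1),
      (u2 = 0 \/ u2 = 1) & (u3 = 0 \/ u3 = 1)] ->
  [/\ u2 + u3 <= y3, u2 + u3 <= 1 - y1, y2 - y1 <= u2 & y3 - y2 <= u3] ->
  [/\ w * (Cmin * y1) <= z1 <= w * (Cmax * y1),
      w * (Cmin * y2) <= z2 <= w * (Cmax * y2) &
      w * (Cmin * y3) <= z3 <= w * (Cmax * y3)] ->
  [/\ z2 - z1 <= w * (V * y1 + Vbar * (1 - y1)),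
      z3 - z2 <= w * (V * y2 + Vbar * (1 - y2)),
      z1 - z2 <= w * (V * y2 + Vbar * (1 - y2)) &
      z2 - z3 <= w * (V * y3 + Vbar * (1 - y3))] ->
  scaled R (uc_space R 3) (uc_feasible 3 2 2 Cmin Cmax Vbar V) w
    (schedule R z1 z2 z3 (w * y1) (w * y2) (w * y3) (w * u2) (w * u3)).
Proof.
move=> Cmin0 Vbar0; rewrite le_eqVlt => /predU1P[<-|w0] hyu hmin hC hR.
  move: hC; rewrite !mul0r => -[hz1 hz2 hz3].
  exists (schedule R 0 0 0 0 0 0 0 0); last first.
    by rewrite scheduleZ !mul0r; congr schedule; apply/eqP; rewrite eq_le andbC.
  apply/uc_feasible3E => //.
  rewrite !xc_schedule !yc_schedule !uc_schedule /feasible_coords /=.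
  by do !split; try (by left); rewrite ?mulr0 ?lexx //; lra.
exists (schedule R (z1 / w) (z2 / w) (z3 / w) y1 y2 y3 u2 u3); last first.
  by rewrite scheduleZ ![w * (_ / w)]mulrC !divfK // gt_eqF.
apply/uc_feasible3E => //.
rewrite !xc_schedule !yc_schedule !uc_schedule /feasible_coords /=.
case: hC => hC1 hC2 hC3; case: hR => hR1 hR2 hR3 hR4.
split=> //; split=> //.
by split; split; rewrite -?mulrBl ?ler_pdivlMr ?ler_pdivrMr //
  ![_ * w]mulrC.
Qed.

(** * The system of inequalities: validity on feasible points and convexity *)

Definition hull_coords (R : realType) (Cmin Cmax Vbar V
    x1 x2 x3 y1 y2 y3 u2 u3 : R) : Prop :=
    u2 + u3 <= y3
    /\ y1 + u2 + u3 <= 1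
    /\ u2 >= y2 - y1
    /\ u3 >= y3 - y2
    /\ u2 >= 0
    /\ u3 >= 0
    /\ x1 >= Cmin * y1
    /\ x2 >= Cmin * y2
    /\ x3 >= Cmin * y3
    /\ x1 <= Vbar * y1 + V * (y2 - u2) + (Cmax - Vbar - V) * (y3 - u3 - u2)
    /\ x2 <= Vbar * y2 + (Cmax - Vbar) * (y3 - u3 - u2)
    /\ x3 <= Cmax * y3 - (Cmax - Vbar) * u3 - (Cmax - Vbar - V) * u2
    /\ x2 - x1 <=
         Vbar * y2 - Cmin * y1 + (Cmin + V - Vbar) * (y3 - u3 - u2)
    /\ x3 - x2 <=
         (Cmin + V) * y3 - Cmin * y2 - (Cmin + V - Vbar) * u3
    /\ x1 - x2 <=
         Vbar * y1 - (Vbar - V) * y2 - (Cmin + V - Vbar) * u2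
    /\ x2 - x3 <=
         Vbar * y2 - Cmin * y3 + (Cmin + V - Vbar) * (y3 - u3 - u2)
    /\ x3 - x1 <=
         (Cmin + 2 * V) * y3 - Cmin * y1 - (Cmin + 2 * V - Vbar) * u3
         - (Cmin + V - Vbar) * u2
    /\ x1 - x3 <=
         Vbar * y1 - Cmin * y3 + V * (y2 - u2)
         + (Cmin + V - Vbar) * (y3 - u3 - u2)
    /\ x1 - x2 + x3 <=
         Vbar * y1 - (Vbar - V) * y2 + Vbar * y3
         + (Cmax - Vbar) * (y3 - u3 - u2).

Lemma feasible_hull_coords (R : realType) (Cmin Cmax Vbar V
    x1 x2 x3 y1 y2 y3 u2 u3 : R) :
  0 <= Cmin -> Cmin <= Vbar -> 0 < V -> Vbar < Cmin + V ->
  0 <= Cmax - Vbar - V -> 0 <= Cmax - Cmin - 2 * V ->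
  feasible_coords R Cmin Cmax Vbar V x1 x2 x3 y1 y2 y3 u2 u3 ->
  hull_coords R Cmin Cmax Vbar V x1 x2 x3 y1 y2 y3 u2 u3.
Proof.
move=> hCmin hCV hV hVbar hCmax1 hCmax2.
move=> [[hy1 hy2 hy3 hu2 hu3] [[hup hdown s2 s3] [[hC1 hC2 hC3]]]].
move: hC1 hC2 hC3 => /andP[hl1 hr1] /andP[hl2 hr2] /andP[hl3 hr3] [r1 r2 r3 r4].
rewrite /hull_coords.
(* Of the 32 binary assignments, all but the six patterns contradict the constraints on [y] and [u];
   on each pattern the 19 inequalities are linear in [x] and the parameters. *)
case: hy1 => ?; case: hy2 => ?; case: hy3 => ?; case: hu2 => ?; case: hu3 => ?;
  subst; try (exfalso; clear - hup hdown s2 s3; lra);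
  clear hup hdown s2 s3; do 18![split; first by lra]; lra.
Qed.

(** Each inequality is affine, so the two instances are combined side by side. The relation
    [k + l = 1] serves for [y1 + u2 + u3 <= 1], the one inequality with a constant term. *)
Lemma hull_coords_convex (R : realType) (Cmin Cmax Vbar V k l
    x1 x2 x3 y1 y2 y3 u2 u3 x1' x2' x3' y1' y2' y3' u2' u3' : R) :
  0 <= k -> 0 <= l -> k + l = 1 ->
  hull_coords R Cmin Cmax Vbar V x1 x2 x3 y1 y2 y3 u2 u3 ->
  hull_coords R Cmin Cmax Vbar V x1' x2' x3' y1' y2' y3' u2' u3' ->
  hull_coords R Cmin Cmax Vbar V
    (k * x1 + l * x1') (k * x2 + l * x2') (k * x3 + l * x3')
    (k * y1 + l * y1') (k * y2 + l * y2') (k * y3 + l * y3')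
    (k * u2 + l * u2') (k * u3 + l * u3').
Proof.
move=> k0 l0 kl.
have comb (p q p' q' : R) : p <= q -> p' <= q' ->
    k * p + l * p' <= k * q + l * q'.
  by move=> pq pq'; rewrite lerD // ler_wpM2l.
rewrite /hull_coords => hp hq.
do 18![case: hp => h hp; case: hq => h' hq; split;
  [by have := comb _ _ _ _ h h'; clear - kl; lra|clear h h']].
by have := comb _ _ _ _ hp hq; clear; lra.
Qed.

(** * The dilated polytopes of the six patterns *)

(** Relations between products with [w], which the calls to [lra] below treat as atoms. *)
Lemma scaled_bounds (R : realType) (Cmin Cmax Vbar V w : R) :
  0 <= Cmin -> Cmin <= Vbar -> 0 < V -> Vbar < Cmin + V ->
  0 <= Cmax - Vbar - V -> 0 <= w ->
  [/\ 0 <= w * Cmin, 0 <= w * Vbar, 0 <= w * V, w * Cmin <= w * Vbar &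
      w * Vbar <= w * Cmin + w * V] /\ w * Vbar + w * V <= w * Cmax.
Proof.
by move=> *; rewrite -!mulrDr !mulr_ge0 ?ler_wpM2l //; lra.
Qed.

Lemma scaled_off (R : realType) (Cmin Cmax Vbar V w : R) :
  0 <= Cmin -> Cmin <= Vbar -> 0 < V -> Vbar < Cmin + V ->
  0 <= Cmax - Vbar - V -> 0 <= w ->
  scaled R _ (uc_feasible 3 2 2 Cmin Cmax Vbar V) w
    (schedule R 0 0 0 0 0 0 0 0).
Proof.
move=> hCmin hCV hV hVbar hK w0.
have [[m1 m2 m3 m4 m5] m6] :=
  scaled_bounds R Cmin Cmax Vbar V w hCmin hCV hV hVbar hK w0.
have := scaled_feasible R Cmin Cmax Vbar V w 0 0 0 0 0 0 0 0
  hCmin (le_trans hCmin hCV) w0.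
clear hCmin hCV hV hVbar hK w0; rewrite !mulr0 ?mulr1; apply.
- by split; [left|left|left|left|left].
- by clear; split; lra.
- by split; apply/andP; split; lra.
- by split; lra.
Qed.

Lemma scaled_on_first (R : realType) (Cmin Cmax Vbar V w a : R) :
  0 <= Cmin -> Cmin <= Vbar -> 0 < V -> Vbar < Cmin + V ->
  0 <= Cmax - Vbar - V -> 0 <= w -> 0 <= a <= w * (Vbar - Cmin) ->
  scaled R _ (uc_feasible 3 2 2 Cmin Cmax Vbar V) w
    (schedule R (w * Cmin + a) 0 0 w 0 0 0 0).
Proof.
move=> hCmin hCV hV hVbar hK w0 /andP[a0 au].
have [[m1 m2 m3 m4 m5] m6] :=
  scaled_bounds R Cmin Cmax Vbar V w hCmin hCV hV hVbar hK w0.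
have := scaled_feasible R Cmin Cmax Vbar V w 1 0 0 0 0 (w * Cmin + a) 0 0
  hCmin (le_trans hCmin hCV) w0.
clear hCmin hCV hV hVbar hK w0; rewrite !mulr0 ?mulr1; apply.
- by split; [right|left|left|left|left].
- by clear; split; lra.
- by split; apply/andP; split; lra.
- by split; lra.
Qed.

(** Shutting down after period 2 caps [x2] at [Vbar]. Then [x1 <= x2 + V] stays below [Cmax] as
    [Vbar + V <= Cmax], and the ramp up from period 1 to 2 holds as [Vbar - Cmin < V]. *)
Lemma scaled_on_first_two (R : realType) (Cmin Cmax Vbar V w b1 b2 : R) :
  0 <= Cmin -> Cmin <= Vbar -> 0 < V -> Vbar < Cmin + V ->
  0 <= Cmax - Vbar - V -> 0 <= w -> 0 <= b1 <= b2 + w * V ->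
  0 <= b2 <= w * (Vbar - Cmin) ->
  scaled R _ (uc_feasible 3 2 2 Cmin Cmax Vbar V) w
    (schedule R (w * Cmin + b1) (w * Cmin + b2) 0 w w 0 0 0).
Proof.
move=> hCmin hCV hV hVbar hK w0 /andP[b10 b1u] /andP[b20 b2u].
have [[m1 m2 m3 m4 m5] m6] :=
  scaled_bounds R Cmin Cmax Vbar V w hCmin hCV hV hVbar hK w0.
have := scaled_feasible R Cmin Cmax Vbar V w 1 1 0 0 0 (w * Cmin + b1)
  (w * Cmin + b2) 0
  hCmin (le_trans hCmin hCV) w0.
clear hCmin hCV hV hVbar hK w0; rewrite !mulr0 ?mulr1; apply.
- by split; [right|right|left|left|left].
- by clear; split; lra.
- by split; apply/andP; split; lra.
- by split; lra.
Qed.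

Lemma scaled_on (R : realType) (Cmin Cmax Vbar V w c1 c2 c3 : R) :
  0 <= Cmin -> Cmin <= Vbar -> 0 < V -> Vbar < Cmin + V ->
  0 <= Cmax - Vbar - V -> 0 <= w ->
  [/\ 0 <= c1 <= w * (Cmax - Cmin), 0 <= c2 <= w * (Cmax - Cmin) &
      0 <= c3 <= w * (Cmax - Cmin)] ->
  [/\ c1 - c2 <= w * V, c2 - c1 <= w * V, c2 - c3 <= w * V &
      c3 - c2 <= w * V] ->
  scaled R _ (uc_feasible 3 2 2 Cmin Cmax Vbar V) w
    (schedule R (w * Cmin + c1) (w * Cmin + c2) (w * Cmin + c3) w w w 0 0).
Proof.
move=> hCmin hCV hV hVbar hK w0 [/andP[c10 c1u] /andP[c20 c2u] /andP[c30 c3u]].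
move=> [r1 r2 r3 r4].
have [[m1 m2 m3 m4 m5] m6] :=
  scaled_bounds R Cmin Cmax Vbar V w hCmin hCV hV hVbar hK w0.
have := scaled_feasible R Cmin Cmax Vbar V w 1 1 1 0 0 (w * Cmin + c1)
  (w * Cmin + c2) (w * Cmin + c3) hCmin
  (le_trans hCmin hCV) w0.
clear hCmin hCV hV hVbar hK w0; rewrite !mulr0 ?mulr1; apply.
- by split; [right|right|right|left|left].
- by clear; split; lra.
- by split; apply/andP; split; lra.
- by split; lra.
Qed.

(** The time reversal of [scaled_on_first_two]. *)
Lemma scaled_on_last_two (R : realType) (Cmin Cmax Vbar V w d2 d3 : R) :
  0 <= Cmin -> Cmin <= Vbar -> 0 < V -> Vbar < Cmin + V ->
  0 <= Cmax - Vbar - V -> 0 <= w -> 0 <= d2 <= w * (Vbar - Cmin) ->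
  0 <= d3 <= d2 + w * V ->
  scaled R _ (uc_feasible 3 2 2 Cmin Cmax Vbar V) w
    (schedule R 0 (w * Cmin + d2) (w * Cmin + d3) 0 w w w 0).
Proof.
move=> hCmin hCV hV hVbar hK w0 /andP[d20 d2u] /andP[d30 d3u].
have [[m1 m2 m3 m4 m5] m6] :=
  scaled_bounds R Cmin Cmax Vbar V w hCmin hCV hV hVbar hK w0.
have := scaled_feasible R Cmin Cmax Vbar V w 0 1 1 1 0 0
  (w * Cmin + d2) (w * Cmin + d3) hCmin
  (le_trans hCmin hCV) w0.
clear hCmin hCV hV hVbar hK w0; rewrite !mulr0 ?mulr1; apply.
- by split; [left|right|right|right|left].
- by clear; split; lra.
- by split; apply/andP; split; lra.
- by split; lra.
Qed.

Lemma scaled_on_last (R : realType) (Cmin Cmax Vbar V w e : R) :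
  0 <= Cmin -> Cmin <= Vbar -> 0 < V -> Vbar < Cmin + V ->
  0 <= Cmax - Vbar - V -> 0 <= w -> 0 <= e <= w * (Vbar - Cmin) ->
  scaled R _ (uc_feasible 3 2 2 Cmin Cmax Vbar V) w
    (schedule R 0 0 (w * Cmin + e) 0 0 w 0 w).
Proof.
move=> hCmin hCV hV hVbar hK w0 /andP[e0 eu].
have [[m1 m2 m3 m4 m5] m6] :=
  scaled_bounds R Cmin Cmax Vbar V w hCmin hCV hV hVbar hK w0.
have := scaled_feasible R Cmin Cmax Vbar V w 0 0 1 0 1 0 0 (w * Cmin + e) hCmin
  (le_trans hCmin hCV) w0.
clear hCmin hCV hV hVbar hK w0; rewrite !mulr0 ?mulr1; apply.
- by split; [left|left|right|left|right].
- by clear; split; lra.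
- by split; apply/andP; split; lra.
- by split; lra.
Qed.

(** * Decomposing a solution of the system over the patterns *)

(** Once [Cmin * y] is subtracted from [x] and [y] is expressed through the weights, the
    inequalities on [x] become the hypotheses of [trajectory_split]. For instance
    [y2 = wB + wC + u2] turns the bound on [x2 - x1] into [b + d + c]. *)
Lemma hull_coords_split (R : realType) (Cmin Cmax Vbar V
    x1 x2 x3 y1 y2 y3 u2 u3 : R) :
  Cmin <= Vbar -> 0 < V -> Vbar < Cmin + V -> 0 <= Cmax - Cmin - 2 * V ->
  hull_coords R Cmin Cmax Vbar V x1 x2 x3 y1 y2 y3 u2 u3 ->
  let wA := y1 - y2 + u2 in let wB := y2 - y3 + u3 in
  let wC := y3 - u2 - u3 in
  let v := Vbar - Cmin in let K := Cmax - Cmin in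
  exists a1 b1 b2 c1 c2 c3 d2 d3 e3 : R,
    [/\ x1 = (wA * Cmin + a1) + (wB * Cmin + b1) + (wC * Cmin + c1),
        x2 = (wB * Cmin + b2) + (wC * Cmin + c2) + (u2 * Cmin + d2) &
        x3 = (wC * Cmin + c3) + (u2 * Cmin + d3) + (u3 * Cmin + e3)] /\
    [/\ 0 <= a1 <= wA * v, 0 <= b1 <= b2 + wB * V, 0 <= b2 <= wB * v,
        0 <= d2 <= u2 * v & 0 <= d3 <= d2 + u2 * V] /\
    [/\ 0 <= e3 <= u3 * v, 0 <= c1 <= wC * K, 0 <= c2 <= wC * K &
        0 <= c3 <= wC * K] /\
    [/\ c1 - c2 <= wC * V, c2 - c1 <= wC * V, c2 - c3 <= wC * V &
        c3 - c2 <= wC * V].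
Proof.
move=> hCV hV hVbar hK.
move=> [g1 [g2 [g3 [g4 [u20 [u30 [l1 [l2 [l3 [t1 [t2 [t3 hx]]]]]]]]]]]].
move: hx => [h21 [h32 [h12 [h23 [h31 [h13 h123]]]]]].
move=> wA wB wC v K.
have wA0 : 0 <= wA by clear - g3; rewrite /wA; lra.
have wB0 : 0 <= wB by clear - g4; rewrite /wB; lra.
have wC0 : 0 <= wC by clear - g1; rewrite /wC; lra.
have v0 : 0 <= v by rewrite subr_ge0.
have vV : v <= V by rewrite lerBlDl ltW.
have VK : 2 * V <= K by rewrite -subr_ge0.
have V0 := ltW hV.
have [] := trajectory_split R (wA * v) (wB * v) (wB * V) (wC * V) (wC * K)
  (u2 * v) (u2 * V) (u3 * v)
  (x1 - Cmin * y1) (x2 - Cmin * y2) (x3 - Cmin * y3).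
- exact: mulr_ge0.
- by rewrite mulr_ge0 ?ler_wpM2l.
- exact: mulr_ge0.
- by rewrite mulrCA ler_wpM2l.
- by rewrite mulr_ge0 ?ler_wpM2l.
- exact: mulr_ge0.
- by clear - l1 t1; rewrite /wA /wB /wC /v /K; apply/andP; split; lra.
- by clear - l2 t2; rewrite /wB /wC /v /K; apply/andP; split; lra.
- by clear - l3 t3; rewrite /wC /v /K; apply/andP; split; lra.
- by clear - h21; rewrite /wB /wC /v; lra.
- by clear - h23; rewrite /wB /wC /v; lra.
- by clear - h12; rewrite /wA /wB /wC /v; lra.
- by clear - h32; rewrite /wC /v; lra.
- by clear - h13; rewrite /wA /wB /wC /v; lra.
- by clear - h31; rewrite /wC /v; lra.
- by clear - h123; rewrite /wA /wB /wC /v /K; lra.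
move=> a1 [b1 [b2 [c1 [c2 [c3 [d2 [d3 [e3 [[x1E x2E x3E] hz]]]]]]]]].
exists a1, b1, b2, c1, c2, c3, d2, d3, e3; split => //; clear hz.
move/eqP: x1E; move/eqP: x2E; move/eqP: x3E; rewrite !subr_eq.
by move=> /eqP-> /eqP-> /eqP->; rewrite /wA /wB /wC; split; ring.
Qed.

Lemma hull_coords_decomposition (R : realType) (Cmin Cmax Vbar V
    x1 x2 x3 y1 y2 y3 u2 u3 : R) (S : set (uc_space R 3)) :
  0 <= Cmin -> Cmin <= Vbar -> 0 < V -> Vbar < Cmin + V ->
  0 <= Cmax - Vbar - V -> 0 <= Cmax - Cmin - 2 * V ->
  convex_set S -> uc_feasible 3 2 2 Cmin Cmax Vbar V `<=` S ->
  hull_coords R Cmin Cmax Vbar V x1 x2 x3 y1 y2 y3 u2 u3 ->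
  S (schedule R x1 x2 x3 y1 y2 y3 u2 u3).
Proof.
move=> hCmin hCV hV hVbar hCmax1 hCmax2 cS FS hp.
(* The feasible set is not convex, so the pieces are moved into dilates of [S] before being
   added. *)
have mono w z : scaled R _ (uc_feasible 3 2 2 Cmin Cmax Vbar V) w z ->
    scaled R _ S w z by move=> [s /FS Ss ->]; exists s.
have := hull_coords_split R Cmin Cmax Vbar V x1 x2 x3 y1 y2 y3 u2 u3
  hCV hV hVbar hCmax2 hp.
case: hp => [g1 [g2 [g3 [g4 [u20 [u30 _]]]]]].
move=> /=; set wA := y1 - y2 + u2; set wB := y2 - y3 + u3.
set wC := y3 - u2 - u3; pose wO := 1 - y1 - u2 - u3.
have wO0 : 0 <= wO by clear - g2; rewrite /wO; lra.
have wA0 : 0 <= wA by clear - g3; rewrite /wA; lra.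
have wB0 : 0 <= wB by clear - g4; rewrite /wB; lra.
have wC0 : 0 <= wC by clear - g1; rewrite /wC; lra.
have y1E : y1 = wA + wB + wC by rewrite /wA /wB /wC; ring.
have y2E : y2 = wB + wC + u2 by rewrite /wB /wC; ring.
have y3E : y3 = wC + u2 + u3 by rewrite /wC; ring.
have w1E : wO + wA + wB + wC + u2 + u3 = 1.
  by rewrite /wO /wA /wB /wC; ring.
(* With the weights made independent variables, [y1], [y2], [y3] can be replaced by sums of weights,
   matching the sum of the six schedules. *)
move: wA wB wC wO wO0 wA0 wB0 wC0 y1E y2E y3E w1E
  => wA wB wC wO wO0 wA0 wB0 wC0 -> -> -> w1E.
move=> [a1 [b1 [b2 [c1 [c2 [c3 [d2 [d3 [e3 [[-> -> ->] hz]]]]]]]]]].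
case: hz => [[ha hb1 hb2 hd2 hd3] [[he hc1 hc2 hc3] hr]].
have hO := mono _ _ (scaled_off R _ _ _ _ wO hCmin hCV hV hVbar hCmax1 wO0).
have hA := mono _ _ (scaled_on_first R _ _ _ _ wA _
  hCmin hCV hV hVbar hCmax1 wA0 ha).
have hB := mono _ _ (scaled_on_first_two R _ _ _ _ wB _ _
  hCmin hCV hV hVbar hCmax1 wB0 hb1 hb2).
have hC := mono _ _ (scaled_on R _ _ _ _ wC _ _ _
  hCmin hCV hV hVbar hCmax1 wC0 (And3 hc1 hc2 hc3) hr).
have hD := mono _ _ (scaled_on_last_two R _ _ _ _ u2 _ _
  hCmin hCV hV hVbar hCmax1 u20 hd2 hd3).
have hE := mono _ _ (scaled_on_last R _ _ _ _ u3 _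
  hCmin hCV hV hVbar hCmax1 u30 he).
have wOA0 := addr_ge0 wO0 wA0; have wOB0 := addr_ge0 wOA0 wB0.
have wOC0 := addr_ge0 wOB0 wC0; have wOD0 := addr_ge0 wOC0 u20.
have := scaledD _ _ _ _ _ _ _ cS wO0 wA0 hO hA.
move=> /(scaledD _ _ _ _ _ _ _ cS wOA0 wB0) /(_ hB).
move=> /(scaledD _ _ _ _ _ _ _ cS wOB0 wC0) /(_ hC).
move=> /(scaledD _ _ _ _ _ _ _ cS wOC0 u20) /(_ hD).
move=> /(scaledD _ _ _ _ _ _ _ cS wOD0 u30) /(_ hE).
(* The total weight is 1, so the sum lies in [S] itself. *)
by rewrite w1E => -[s Ss]; rewrite scale1r !scheduleD !add0r !addr0 => ->.
Qed.

(** * Equality of the hull and the polytope *)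

Theorem theorem2 (R : realType) (Cmin Cmax Vbar V : R)
    (hCmin : 0 <= Cmin) (hCV : Cmin <= Vbar) (hVC : Vbar <= Cmax) (hV : 0 < V)
    (hVbar : Vbar < Cmin + V)
    (hCmax1 : 0 <= Cmax - Vbar - V)
    (hCmax2 : 0 <= Cmax - Cmin - 2 * V) :
  convex_hull (uc_feasible 3 2 2 Cmin Cmax Vbar V) =
  [set p : uc_space R 3 |
    let x1 := xc p 1 in let x2 := xc p 2 in let x3 := xc p 3 in
    let y1 := yc p 1 in let y2 := yc p 2 in let y3 := yc p 3 in
    let u2 := uc p 2 in let u3 := uc p 3 in
    u2 + u3 <= y3
    /\ y1 + u2 + u3 <= 1
    /\ u2 >= y2 - y1
    /\ u3 >= y3 - y2
    /\ u2 >= 0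
    /\ u3 >= 0
    /\ x1 >= Cmin * y1
    /\ x2 >= Cmin * y2
    /\ x3 >= Cmin * y3
    /\ x1 <= Vbar * y1 + V * (y2 - u2) + (Cmax - Vbar - V) * (y3 - u3 - u2)
    /\ x2 <= Vbar * y2 + (Cmax - Vbar) * (y3 - u3 - u2)
    /\ x3 <= Cmax * y3 - (Cmax - Vbar) * u3 - (Cmax - Vbar - V) * u2
    /\ x2 - x1 <=
         Vbar * y2 - Cmin * y1 + (Cmin + V - Vbar) * (y3 - u3 - u2)
    /\ x3 - x2 <=
         (Cmin + V) * y3 - Cmin * y2 - (Cmin + V - Vbar) * u3
    /\ x1 - x2 <=
         Vbar * y1 - (Vbar - V) * y2 - (Cmin + V - Vbar) * u2
    /\ x2 - x3 <=
         Vbar * y2 - Cmin * y3 + (Cmin + V - Vbar) * (y3 - u3 - u2)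
    /\ x3 - x1 <=
         (Cmin + 2 * V) * y3 - Cmin * y1 - (Cmin + 2 * V - Vbar) * u3
         - (Cmin + V - Vbar) * u2
    /\ x1 - x3 <=
         Vbar * y1 - Cmin * y3 + V * (y2 - u2)
         + (Cmin + V - Vbar) * (y3 - u3 - u2)
    /\ x1 - x2 + x3 <=
         Vbar * y1 - (Vbar - V) * y2 + Vbar * y3
         + (Cmax - Vbar) * (y3 - u3 - u2)].
Proof.
apply/seteqP; split.
  apply: smallest_sub => [p q k /set_mem hp /set_mem hq|p].
    have [k0 l0 kl] : [/\ 0 <= k%:num, 0 <= 1 - k%:num &
        k%:num + (1 - k%:num) = 1] by rewrite subr_ge0 ge0 le1 subrKC.
    apply/mem_set.
    have := hull_coords_convex R Cmin Cmax Vbar V _ _ _ _ _ _ _ _ _ _ _ _ _ _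
      _ _ _ _ k0 l0 kl hp hq.
    by rewrite -!component_affine.
  by move/(uc_feasible3E _ _ _ _ _ _ hCmin); exact: feasible_hull_coords.
(* Lying in the hull means lying in every convex [S] that contains the feasible set. *)
move=> p hp S [cS FS]; rewrite [p]scheduleE.
exact: hull_coords_decomposition FS hp.
Qed.
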